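(* Let $k\ge 1$ be an integer, let $N(k)=4k(4k+1)$, and let $X_{1,t},X_{2,t},Y_t$ ($t=1,2,\dots,4k-1$) be indeterminates. Define \begin{align*} f_0(t,j)&=((N(k)+j)Y_t-X_{2,t})(-4)^k,\\ f_1(t,j)&=-((4N(k)+4j+2)Y_t-4X_{1,t})(-4)^k,\\ g_0(t,j)&=X_{2,t}-jY_t,\\ g_1(t,j)&=-(4X_{1,t}-(4j+2)Y_t). \end{align*} For $\ell=1,2,\dots,4k$ let $F^X_\ell$ (resp.\ $G^X_\ell$) be the $(4k-1)\times(4k)$ matrix whose only nonzero entries are, for $t=1,\dots,4k-1$, the $(t,t)$-entry $f_1(t,4(\ell-1)k+t)$ and the $(t,t+1)$-entry $f_0(t,4(\ell-1)k+t+1)$ (resp.\ the $(t,t)$-entry $g_1(t,4(\ell-1)k+t)$ and the $(t,t+1)$-entry $g_0(t,4(\ell-1)k+t+1)$). For $\ell=1,\dots,4k$ let $x_\ell$ be the row vector of length $4k$ whose entries are all zero except the last one, which equals $$u_\ell=(-1)^{\ell-1}(-4)^{(\ell+1)k}\,8k(4k+1)\left(\prod_{i=1}^{4k-\ell}(4ik-1)\right)\left(\prod_{i=1}^{\ell-1}(4ik+1)\right).$$ Let $M^X$ be the $16k^2\times 16k^2$ block matrix $$M^X=\begin{pmatrix} x_1&x_2&x_3&\dots&x_{4k}\\ F^X_1&0&0&\dots&0\\ G^X_1&F^X_2&0&\dots&0\\ 0&G^X_2&F^X_3&\dots&0\\ \vdots&&\ddots&\ddots&\vdots\\ & & &G^X_{4k-1}&F^X_{4k}\\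 0& \dots& &0 & G^X_{4k} \end{pmatrix},$$ i.e.\ a first row $(x_1,\dots,x_{4k})$ followed by $4k+1$ block rows, the $r$-th of which has $F^X_r$ in block column $r$ (for $r\le 4k$) and $G^X_{r-1}$ in block column $r-1$ (for $r\ge 2$), all other blocks zero. Then \begin{multline*} \det M^X=(-1)^{k-1}4^{2k(4k^2+7k+2)}k^{2k(4k+1)} \prod _{i=1} ^{4k}(i+1)_{4k-i+1} \times \prod _{a=1}^{4k-1}\left(2X_{1,a}-(32k^2+2a-1)Y_a\right)\\ \times \prod _{1\le a\le b\le 4k-1} (2X_{2,b}Y_a-2X_{1,a}Y_b-(2b-2a+1)Y_aY_b), \end{multline*} where $(\alpha)_k:=\alpha(\alpha+1)\cdots(\alpha+k-1)$ for $k\ge1$ and $(\alpha)_0:=1$ (shifted factorials).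
   Context: This determinant arises in proving that, for every $k\ge1$, a series $\pi=\sum_{n\ge0} S_k(n)/\big(\binom{8kn}{4kn}(-4)^{kn}\big)$ with $S_k$ a polynomial of degree $4k$ exists: the coefficient matrix of the linear system determining $S_k$ has determinant equal (up to nonzero factors) to $\det M^X$ specialized at $X_{1,t}=X_{2,t}=N(k)$, $Y_t=1$, which is nonzero by the formula. *)

(* Defs.v *)
From mathcomp Require Import all_boot all_order all_algebra.
Set Implicit Arguments. Unset Strict Implicit. Unset Printing Implicit Defensive.
Import GRing.Theory.
Local Open Scope ring_scope.

Definition shifted_fact (alpha m : nat) : nat := (\prod_(0 <= i < m) (alpha + i))%N.

Definition Nk (k : nat) : nat := (4 * k * (4 * k + 1))%N.

Section Entries.
Variable R : comNzRingType.
Variable k : nat.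
(* indeterminates X_{1,t}, X_{2,t}, Y_t (only t = 1..4k-1 are used) *)
Variables X1 X2 Y : nat -> R.

Definition f0 (t j : nat) : R :=
  (((Nk k + j)%:R * Y t - X2 t) * (-4) ^+ k).
Definition f1 (t j : nat) : R :=
  - (((4 * Nk k + 4 * j + 2)%:R * Y t - 4 * X1 t) * (-4) ^+ k).
Definition g0 (t j : nat) : R := X2 t - j%:R * Y t.
Definition g1 (t j : nat) : R := - (4 * X1 t - (4 * j + 2)%:R * Y t).

(* (t,s)-entry (1-based, t = 1..4k-1, s = 1..4k) of F^X_l and G^X_l,
   the (4k-1) x (4k) matrices with only entries at (t,t) and (t,t+1) *)
Definition F_entry (l t s : nat) : R :=
  if s == t then f1 t (4 * (l - 1) * k + t)
  else if s == t.+1 then f0 t (4 * (l - 1) * k + t + 1)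
  else 0.
Definition G_entry (l t s : nat) : R :=
  if s == t then g1 t (4 * (l - 1) * k + t)
  else if s == t.+1 then g0 t (4 * (l - 1) * k + t + 1)
  else 0.

Definition u (l : nat) : R :=
  (-1) ^+ (l - 1) * (-4) ^+ ((l + 1) * k) * (8 * k * (4 * k + 1))%:R
  * (\prod_(1 <= i < (4 * k - l).+1) (4 * i * k - 1)%:R)
  * (\prod_(1 <= i < l) (4 * i * k + 1)%:R).

(* s-th entry (1-based) of the row vector x_l of length 4k *)
Definition x_entry (l s : nat) : R := if s == 4 * k then u l else 0.

(* Entry (r, c) (0-based) of M^X, which is 16k^2 x 16k^2.
   Row 0 is (x_1, ..., x_{4k}); rows 1 + (br-1)(4k-1) + (t-1), t = 1..4k-1,
   form block row br = 1..4k+1.  Column c lies in block column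
   c / (4k) + 1 at position c mod 4k + 1.  Block row br has F^X_br in block
   column br and G^X_(br-1) in block column br-1. *)
Definition MX_entry (r c : nat) : R :=
  let bc := (c %/ (4 * k)).+1 in
  let s := (c %% (4 * k)).+1 in
  if r == 0%N then x_entry bc s
  else
    let br := ((r - 1)%N %/ (4 * k).-1).+1 in
    let t := ((r - 1)%N %% (4 * k).-1).+1 in
    if bc == br then F_entry br t s
    else if bc.+1 == br then G_entry bc t s
    else 0.

Definition MX : 'M[R]_(16 * k ^ 2) := \matrix_(r, c) MX_entry r c.

End Entries.

(* Main.v *)
(* Let n = 4k and w = (-4)^k.  Reading the column (l, s) of M^X as the monomial
   z^(l-1) of a polynomial P_s and dividing P_s by (z - w)^(n+1), the block rows t
   become 4 Y_t (Theta - alpha_t) on P_t and - Y_t (Theta - beta_t) on P_(t+1), where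
   Theta = n z d/dz, alpha_t = X_(1,t)/Y_t - t - 1/2 - N(k) and
   beta_t = X_(2,t)/Y_t - t - 1 - N(k).  The first row is, up to a constant, an
   eigenvector of the transpose of Theta, with eigenvalue -(n+1).
   Theta maps (z - w)^(-m) to - n m (z - w)^(-m) - n m w (z - w)^(-m-1), so the
   Newton products (Theta - alpha_1) ... (Theta - alpha_j) (z - w)^(-2) form bases of
   the source and of the target, with changes of basis triangular in powers of z - w.
   In these bases the matrix is sparse, and triangular after a permutation of its
   rows, its diagonal consisting of the 4 Y_t, of the Y_t (beta_t - alpha_a) with
   a <= t, and of a value of the first row. *)
Require Import Defs.
From mathcomp Require Import all_boot all_order all_algebra all_fingroup.
From mathcomp Require Import ring zify mpoly fraction.
Set Implicit Arguments. Unset Strict Implicit. Unset Printing Implicit Defensive.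
Import GRing.Theory.
Local Open Scope ring_scope.

(** * Determinants from one surviving permutation or from triangular factors *)

(** If a permutation [p] has a nonzero product, then [rk (p r) <= rk (s r)] for every row [r]. Both
    sides have the same sum over the rows, so all these inequalities are equalities, which forces
    [p = s]. *)
Lemma det_matching (R : comNzRingType) (N : nat) (A : 'M[R]_N) (s : 'S_N)
    (rk : 'I_N -> nat) :
  (forall r c, A r c != 0 -> c != s r -> (rk c < rk (s r))%N) ->
  \det A = (-1) ^+ s * \prod_r A r (s r).
Proof.
move=> rkA; rewrite /determinant (bigD1 s) //= [X in _ + X]big1 ?addr0 // => p ps.
suff /existsP[r /eqP Ar0] : [exists r, A r (p r) == 0].
  by rewrite (bigD1 r) //= Ar0 mul0r mulr0.
apply: contraNT ps; rewrite negb_exists => /forallP /= Ap.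
have le_rk r : (rk (p r) <= rk (s r) ?= iff (p r == s r))%N.
  case: eqP => [->|/eqP psr]; first by split; rewrite ?eqxx.
  by have /ltn_eqF := rkA _ _ (Ap r) psr; split; rewrite // ltnW // rkA.
have sum_rk (q : 'S_N) : (\sum_r rk (q r) = \sum_r rk r)%N.
  by rewrite [RHS](reindex_inj (@perm_inj _ q)).
have [_] := leqif_sum (fun r (_ : true) => le_rk r).
rewrite !sum_rk eqxx => /esym/forallP psE.
by apply/eqP/permP => r; apply/eqP; have:= psE r.
Qed.

Lemma odd_perm_period (N m : nat) (s : 'S_N) :
  odd m -> (forall x, iter m s x = x) -> s = false :> bool.
Proof.
move=> m_odd sm; have /(congr1 (@odd_perm _)) : (s ^+ m)%g = 1%g.
  by apply/permP => x; rewrite permX perm1.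
rewrite odd_perm1 => {sm} sm0; rewrite -sm0.
have -> : forall j, odd_perm (s ^+ j)%g = odd j && s.
  elim=> [|j IH]; first by rewrite expg0 odd_perm1.
  by rewrite expgS odd_permM IH /=; case: (odd j) (odd_perm s) => [] [].
by rewrite m_odd.
Qed.

(* The matrix is the product of the unitriangular matrix expanding the powers
   of ['X - w] and of the triangular matrix expanding in these powers. *)
Lemma det_coef_basis (R : idomainType) (N : nat) (cls lev : 'I_N -> nat)
    (w : R) (Q : 'I_N -> {poly R}) :
  (forall c d, cls c = cls d -> (lev c <= lev d)%N -> (c <= d)%N) ->
  (forall d l, (l < lev d + size (Q d))%N ->
     exists c, cls c = cls d /\ lev c = l) ->
  \det (\matrix_(c, d) (if cls c == cls d
          then (('X - w%:P) ^+ lev d * Q d)`_(lev c) else 0))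
    = \prod_d (Q d).[w].
Proof.
move=> mono full.
pose C1 : 'M[R]_N := \matrix_(c, d) (if cls c == cls d
          then (('X - w%:P) ^+ lev d)`_(lev c) else 0).
pose C2 : 'M[R]_N := \matrix_(c, d) (if cls c == cls d
          then ('X ^+ lev d * (Q d \Po ('X + w%:P)))`_(lev c) else 0).
have lev_inj c d : cls c = cls d -> lev c = lev d -> c = d.
  by move=> cd lcd; apply/val_inj/anti_leq; rewrite !mono ?lcd.
have -> : (\matrix_(c, d) (if cls c == cls d
          then (('X - w%:P) ^+ lev d * Q d)`_(lev c) else 0)) = C1 *m C2.
  apply/matrixP => c d; rewrite !mxE.
  pose P := 'X ^+ lev d * (Q d \Po ('X + w%:P)).
  have szP : (size P <= lev d + size (Q d))%N.
    rewrite /P; apply: leq_trans (size_polyMleq _ _) _.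
    by rewrite size_polyXn /= size_comp_poly2 // size_XaddC.
  have PE : ('X - w%:P) ^+ lev d * Q d = P \Po ('X - w%:P).
    rewrite /P comp_polyM comp_Xn_poly -comp_polyA comp_polyD comp_polyX comp_polyC.
    by rewrite subrK comp_polyXr.
  rewrite PE comp_polyE; case: eqP => [ccd|ccd]; last first.
    rewrite big1 // => e _; rewrite !mxE.
    case: eqP => // ce; case: eqP => [ed|]; rewrite ?mul0r ?mulr0 //.
    by case: ccd; rewrite ce.
  pose F i := (('X - w%:P) ^+ i)`_(lev c) * P`_i.
  (* Every degree below [size P] is the level of exactly one index of the class of [d]: [full] gives
     existence and [lev_inj] uniqueness. The matrix product thus runs over the powers of
     ['X - w]. *)
  transitivity (\sum_e \sum_(i < size P | (cls e == cls d) && (lev e == i)) F i).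
    rewrite (exchange_big_dep predT) //= coef_sum; apply: eq_bigr => i _.
    have [e [ed ei]] := full d i (leq_trans (ltn_ord i) szP).
    rewrite (big_pred1 e) ?coefZ 1?mulrC // => e' /=.
    apply/andP/eqP => [[/eqP e'd /eqP e'i]|->]; last by rewrite ed ei.
    by apply: lev_inj; rewrite ?ed ?ei.
  apply: eq_bigr => e _; rewrite !mxE ccd (eq_sym (cls d)) -/P.
  have [_|_] := eqVneq (cls e) (cls d) => /=; last by rewrite big_pred0 ?mul0r.
  have [eP|eP] := ltnP (lev e) (size P); first by rewrite (big_pred1 (Ordinal eP)).
  rewrite big_pred0 ?[P`__]nth_default ?mulr0 // => i.
  by apply/negbTE; rewrite neq_ltn (leq_trans (ltn_ord i) eP) orbT.
(* [C1] is upper triangular with unit diagonal; [C2] is lower triangular, and its diagonal entry at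
   [d] is the constant coefficient of [Q d] recentred at [w]. *)
rewrite det_mulmx -[\det C1]det_tr !det_trig.
- rewrite big1 => [|c _]; last first.
    rewrite !mxE eqxx; have := monicXsubC w => /(monic_exp (lev c))/monicP.
    by rewrite lead_coefE size_exp_XsubC.
  rewrite mul1r; apply: eq_bigr => c _; rewrite mxE eqxx coefXnM ltnn subnn.
  by rewrite -horner_coef0 horner_comp !hornerE.
- apply/is_trig_mxP => c d cd; rewrite mxE; case: eqP => // ccd.
  rewrite coefXnM ifT // ltnNge; apply/negP => /(mono _ _ (esym ccd)).
  by rewrite leqNgt cd.
- apply/is_trig_mxP => c d cd; rewrite !mxE; case: eqP => // ccd.
  apply: nth_default; rewrite size_exp_XsubC ltnNge.
  by apply/negP => /(mono _ _ ccd); rewrite leqNgt cd.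
Qed.

Lemma coef_derivM (R : nzRingType) (p : {poly R}) i :
  p^`()`_i = i.+1%:R * p`_i.+1.
Proof. by rewrite coef_deriv mulr_natl. Qed.

(** * Newton products of the operator Theta *)

Section NewtonBasis.

Variables (K : fieldType) (n : nat) (w : K) (al : nat -> K).

(* [(newton j) / (X - w)^(j+2)] is the product of the operators [n X d/dX - al i],
   [1 <= i <= j], applied to [1 / (X - w)^2]. *)
Fixpoint newton (j : nat) : {poly K} :=
  if j is i.+1 then
    n%:R * (('X - w%:P) * 'X * (newton i)^`() - (i.+2)%:R * 'X * newton i)
    - (al j)%:P * ('X - w%:P) * newton i
  else 1.

(* The operator [n X d/dX - a] on [P / (X - w)^(n+1)], with the denominator
   [(X - w)^(n+2)] removed. *)
Definition theta_op (a : K) (P : {poly K}) : {poly K} :=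
  n%:R * (('X - w%:P) * 'X * P^`() - n.+1%:R * 'X * P)
  - a%:P * ('X - w%:P) * P.

Lemma newtonS j : newton j.+1 =
    n%:R * (('X - w%:P) * 'X * (newton j)^`() - (j.+2)%:R * 'X * newton j)
    - (al j.+1)%:P * ('X - w%:P) * newton j.
Proof. by []. Qed.

Lemma size_newton j : (size (newton j) <= j.+1)%N.
Proof.
elim: j => [|j /leq_sizeP IH]; first by rewrite size_polyC leq_b1.
apply/leq_sizeP => -[|[|i]] // ij.
rewrite newtonS !(mulrBl, mulrBr) -!mulrA -!polyC_natr.
rewrite !(coefB, coefCM, coefXM) /= coef_deriv.
by rewrite ?coefXM /= ?coef_deriv !IH ?mul0rn ?mulr0 ?subr0 //; lia.
Qed.

(** At [w] all terms of the recursion with a factor ['X - w] vanish, so each step only multiplies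
    the value by [- n (j + 2) w]. The nodes [al] do not enter. *)
Lemma newton_at_pole j : (newton j).[w] = (- (n%:R * w)) ^+ j * (j.+1)`!%:R.
Proof.
elim: j => [|j IH]; first by rewrite /= hornerC mulr1.
rewrite newtonS -!polyC_natr !hornerE IH exprS [in RHS]factS natrM; ring.
Qed.

Lemma deriv_subXn p :
  ('X - w%:P) * (('X - w%:P) ^+ p)^`() = p%:R * ('X - w%:P) ^+ p.
Proof.
rewrite deriv_exp derivB derivX derivC subr0 mul1r.
by case: p => [|p]; rewrite ?mulr0n ?mulr0 ?mul0r // exprS /= -mulr_natl; ring.
Qed.

(** Split Theta - a as (Theta - [al j.+1]) + ([al j.+1] - a). The condition on [n] makes the
    argument, over [('X - w) ^+ n.+1], equal to the Newton product [newton j / ('X - w) ^+ j.+2], so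
    the first summand just lengthens this product. *)
Lemma theta_op_newton a p j : n = (p + j).+1 ->
  theta_op a (('X - w%:P) ^+ p * newton j)
  = ('X - w%:P) ^+ p * newton j.+1
    + (al j.+1 - a)%:P * (('X - w%:P) ^+ p.+1 * newton j).
Proof.
move=> nE; have dX := deriv_subXn p.
rewrite /theta_op newtonS derivM.
have -> : n.+1%:R = p%:R + j.+2%:R :> {poly K} by rewrite nE -natrD; congr _%:R; lia.
rewrite [X in n%:R * (X - _)](_ : _ =
  'X * newton j * (('X - w%:P) * (('X - w%:P) ^+ p)^`())
  + ('X - w%:P) * 'X * (('X - w%:P) ^+ p * (newton j)^`())); last by ring.
rewrite dX polyCB exprS; ring.
Qed.

(** The operator links only neighbouring coefficients: the coefficient of index [r] will match the
    block F, the one of index [r - 1] the block G. *)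
Lemma coef_theta_op a P r :
  (theta_op a P)`_r
  = (if r is i.+1 then (n%:R * i%:R - (n * n.+1)%:R - a) * P`_i else 0)
    - w * (n%:R * r%:R - a) * P`_r.
Proof.
rewrite /theta_op !(mulrBl, mulrBr) -!mulrA -!polyC_natr !(coefB, coefCM, coefXM).
case: r => [|r] /=; first by rewrite ?coefXM /=; ring.
rewrite ?(coefCM, coefXM) /= ?coef_derivM.
case: r => [|r] /=; rewrite ?coefXM /= ?coef_derivM; ring.
Qed.

(** * The first row as an eigenfunctional of Theta *)

Section Functional.

Variable u : nat -> K.
Hypothesis u_rec : forall l, (l.+1 < n)%N ->
  u l.+1 * (n%:R * (l.+1%:R - n%:R) + 1) = w * (n * l.+1 + 1)%:R * u l.

Definition row_form (P : {poly K}) : K := \sum_(l < n) u l * P`_l.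

Lemma row_formD P Q : row_form (P + Q) = row_form P + row_form Q.
Proof. by rewrite -big_split; apply: eq_bigr => l _; rewrite coefD mulrDr. Qed.

Lemma row_formCM a P : row_form (a%:P * P) = a * row_form P.
Proof. by rewrite mulr_sumr; apply: eq_bigr => l _; rewrite coefCM mulrCA. Qed.

(* Integration by parts against [X^((n+1)/n) dX/X]. *)
Lemma row_form_deriv (S : {poly K}) : (size S < n)%N ->
  row_form (n%:R * (('X - w%:P) * 'X * S^`() - n%:R * 'X * S)
            + n.+1%:R * (('X - w%:P) * S)) = 0.
Proof.
move=> szS; rewrite /row_form.
have cE l : (n%:R * (('X - w%:P) * 'X * S^`() - n%:R * 'X * S)
            + n.+1%:R * (('X - w%:P) * S))`_l
  = (if l is i.+1 then (n%:R * (l%:R - n%:R) + 1) * S`_i else 0)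
    - w * (n * l.+1 + 1)%:R * S`_l.
  rewrite !(mulrBl, mulrBr) -!mulrA -[n.+1%:R]natr1 -!polyC_natr.
  rewrite !(mulrDl, mul1r, coefD, coefN, coefCM, coefXM).
  case: l => [|l]; first by rewrite muln1 /=; ring.
  rewrite natrD natrM -[l.+2%:R]natr1 /= ?(coefCM, coefXM) /= ?coef_derivM.
  case: l => [|l] /=; rewrite ?coefXM /= ?coef_derivM; ring.
pose f l := u l * (if l is i.+1 then (n%:R * (l%:R - n%:R) + 1) * S`_i else 0).
pose g l := u l * (w * (n * l.+1 + 1)%:R * S`_l).
transitivity (\sum_(0 <= l < n) f l - \sum_(0 <= l < n) g l).
  by rewrite -sumrB big_mkord; apply: eq_bigr => l _; rewrite cE mulrBr.
have nE : n = n.-1.+1 by case: n szS.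
(* [f 0] vanishes by definition and the last [g] because [size S < n]; the remaining [f l.+1] and
   [g l] cancel by [u_rec]. *)
rewrite nE big_nat_recl // big_nat_recr //= /f /g mulr0 add0r.
rewrite [S`_n.-1]nth_default -1?ltnS -?nE // !mulr0 addr0.
rewrite -sumrB big_nat big1 // => l ln.
by rewrite !mulrA u_rec; [ring | rewrite nE ltnS].
Qed.

(** Under the functional Theta acts as the scalar [- n.+1], by [row_form_deriv], so each factor
    Theta - [al a] comes out as [- (n.+1 + al a)]. *)
Lemma row_form_newton p j : n = (p + j).+1 ->
  row_form (('X - w%:P) ^+ p * newton j)
  = \prod_(1 <= a < j.+1) (- (n.+1%:R + al a)) * row_form (('X - w%:P) ^+ n.-1).
Proof.
elim: j p => [|j IH] p nE; first by rewrite big_geq // mul1r mulr1 nE addn0.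
rewrite big_nat_recr // [in RHS]mulrAC -(IH p.+1) ?addSnnS //.
(* Over [('X - w) ^+ n] this is the Newton product with [j] factors; its degree is at most
   [p + j = n - 2], as integration by parts requires. *)
set S := ('X - w%:P) ^+ p * newton j.
have szS : (size S < n)%N.
  apply: leq_ltn_trans (size_polyMleq _ _) _.
  by rewrite size_exp_XsubC; have := size_newton j; move: (size (newton j)) => z; lia.
have := row_form_deriv szS.
have -> : n%:R * (('X - w%:P) * 'X * S^`() - n%:R * 'X * S) =
   ('X - w%:P) ^+ p * newton j.+1 + (al j.+1)%:P * (('X - w%:P) ^+ p.+1 * newton j).
  rewrite newtonS /S derivM.
  have -> : n%:R = p%:R + j.+2%:R :> {poly K} by rewrite nE -natrD; congr _%:R; lia.
  rewrite [X in (p%:R + _) * (X - _)](_ : _ =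
    'X * newton j * (('X - w%:P) * (('X - w%:P) ^+ p)^`())
    + ('X - w%:P) * 'X * (('X - w%:P) ^+ p * (newton j)^`())); last by ring.
  rewrite deriv_subXn exprS; ring.
rewrite -polyC_natr !row_formD !row_formCM /S mulrA -exprS.
by move=> /eqP; rewrite -addrA addr_eq0 => /eqP ->; ring.
Qed.

End Functional.
End NewtonBasis.

(** * A Vandermonde convolution and sums over blocks *)

(** Induction by Pascal's rule: for [p + q = m] the new factor [c m + a + b] splits as
    [(c p + a) + (c q + b)], and each summand lengthens one of the two products. *)
Lemma prod_rising_vandermonde (R : comNzRingType) (c a b : R) (m : nat) :
  \sum_(l < m.+1) 'C(m, l)%:R
     * (\prod_(0 <= i < m - l) (c * i%:R + a) * \prod_(0 <= i < l) (c * i%:R + b))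
  = \prod_(0 <= i < m) (c * i%:R + (a + b)).
Proof.
elim: m => [|m IH]; first by rewrite big_ord1 !big_geq // !mulr1.
pose F p q : R := \prod_(0 <= i < p) (c * i%:R + a) * \prod_(0 <= i < q) (c * i%:R + b).
have Fl p q : F p.+1 q = F p q * (c * p%:R + a) by rewrite /F big_nat_recr //=; ring.
have Fr p q : F p q.+1 = F p q * (c * q%:R + b) by rewrite /F big_nat_recr //=; ring.
rewrite big_nat_recr // -IH /= mulr_suml.
transitivity (\sum_(l < m.+1) 'C(m, l)%:R * (F (m - l).+1 l + F (m - l)%N l.+1)).
  under [RHS]eq_bigr => l _ do rewrite mulrDr.
  rewrite big_split /= big_ord_recl [X in X + _ = _](_ : _ = F m.+1 0).
    2: by rewrite bin0 mul1r.
  rewrite [in RHS]big_ord_recl /= bin0 mul1r subn0 -addrA; congr (_ + _).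
  rewrite -[in RHS](big_mkord xpredT (fun l => 'C(m, l)%:R * F (m - l)%N l.+1)).
  rewrite /bump /=; under eq_bigr => l _ do rewrite add1n binS natrD mulrDl subSS.
  rewrite big_split /= (big_mkord xpredT); congr (_ + _).
  rewrite big_ord_recr /= bin_small // mul0r addr0; apply: eq_bigr => l _.
  by rewrite /bump add1n -subSn.
apply: eq_bigr => l _; rewrite Fl Fr -/(F _ _) -mulrDr mulrA; congr (_ * _).
by rewrite -[in RHS](subnK (ltn_ord l : (l <= m)%N)) natrD; ring.
Qed.

Lemma big_nat_blocks (R : Type) (idx : R) (op : Monoid.law idx) (m n : nat)
    (F : nat -> R) :
  \big[op/idx]_(0 <= c < m * n) F c
  = \big[op/idx]_(0 <= l < m) \big[op/idx]_(0 <= j < n) F (l * n + j)%N.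
Proof.
rewrite big_nat_mul; apply: eq_bigr => l _.
rewrite -{1}[(l * n)%N]add0n big_addn mulSn addnK.
by apply: eq_bigr => j _; rewrite addnC.
Qed.

Lemma sum_residue (V : nmodType) (m n s : nat) (F : nat -> V) : (s < n)%N ->
  \sum_(0 <= c < m * n) (if (c %% n)%N == s then F c else 0)
  = \sum_(0 <= l < m) F (l * n + s)%N.
Proof.
move=> sn; rewrite big_nat_blocks; apply: eq_bigr => l _.
rewrite big_mkord (bigD1 (Ordinal sn)) //= modnMDl modn_small // eqxx.
by rewrite big1 ?addr0 // => j; rewrite -val_eqE modnMDl modn_small // => /negbTE /= ->.
Qed.

(** * Sparse form of the matrix in the Newton bases *)

Section Factorization.

Variables (K : fieldType) (k : nat).
Hypothesis k_gt0 : (0 < k)%N.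
Variables X1 X2 Y : nat -> K.
Hypothesis Y_neq0 : forall t, Y t != 0.
Hypothesis nat_neq0 : forall m, m.+1%:R != 0 :> K.

Local Notation n := (4 * k)%N.
Local Notation N := (16 * k ^ 2)%N.
Local Notation w := ((-4) ^+ k : K).

Definition alpha t : K := X1 t / Y t - t%:R - 2^-1 - (Nk k)%:R.
Definition beta t : K := X2 t / Y t - t.+1%:R - (Nk k)%:R.

(** Numerators of the Newton products with [n - p.+1] factors over [('X - w) ^+ n.+1], and in
    [row_poly] of those with [n - q] factors over [('X - w) ^+ n.+2]. *)
Definition col_poly p : {poly K} :=
  ('X - w%:P) ^+ p * newton n w alpha (n - p.+1)%N.
Definition row_poly q : {poly K} := ('X - w%:P) ^+ q * newton n w alpha (n - q)%N.

Definition u_form := row_form n (fun l => u K k l.+1).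

(* Column index d is (p, s) with the basis vector of degree j = n - 1 - p, row index
   r is (q, t) with that of degree i = n - q: reversing the degrees makes the
   changes of basis triangular in the flat indexing. *)
Definition sparse_entry (r d : nat) : K :=
  let p := (d %/ n)%N in
  let s := (d %% n).+1 in
  if r == 0%N then (if s == n then u_form (col_poly p) else 0)
  else
    let q := ((r - 1) %/ n.-1)%N in
    let t := ((r - 1) %% n.-1).+1 in
    if s == t then
      4 * Y t * ((q == p)%:R + (q == p.+1)%:R * (alpha (n - p)%N - alpha t))
    else if s == t.+1 then
      - Y t * ((q == p)%:R + (q == p.+1)%:R * (alpha (n - p)%N - beta t))
    else 0.

(** The first row is a class by itself, of level 0 and with polynomial 1, so the change of basis of
    the target leaves it fixed. *)
Definition row_cls r := if r == 0%N then 0%N else ((r - 1) %% n.-1).+1.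
Definition row_lev r := if r == 0%N then 0%N else ((r - 1) %/ n.-1)%N.
Definition row_newton r :=
  if r == 0%N then 1 else newton n w alpha (n - row_lev r)%N.

Definition sparse_mx : 'M[K]_N := \matrix_(r, d) sparse_entry r d.
Definition col_basis_mx : 'M[K]_N := \matrix_(c, d)
  (if (c %% n)%N == (d %% n)%N
   then (('X - w%:P) ^+ (d %/ n)%N * newton n w alpha (n - (d %/ n).+1)%N)`_(c %/ n)%N
   else 0).
Definition row_basis_mx : 'M[K]_N := \matrix_(r, q)
  (if row_cls r == row_cls q
   then (('X - w%:P) ^+ row_lev q * row_newton q)`_(row_lev r) else 0).

Lemma size_MX_cols : N = (n * n)%N. Proof. ring. Qed.
Lemma size_MX_rows : N = (n.+1 * n.-1).+1. Proof.
have [m mE] : exists m, n = m.+1 by exists n.-1; lia.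
by rewrite size_MX_cols mE /=; lia.
Qed.

Lemma MX_entry_block r c t s :
  (t < n.-1)%N -> (s < n)%N ->
  MX_entry k X1 X2 Y (r * n.-1 + t).+1 (c * n + s)
  = if c == r then F_entry k X1 X2 Y r.+1 t.+1 s.+1
    else if c.+1 == r then G_entry k X1 X2 Y r t.+1 s.+1 else 0.
Proof.
move=> tn sn; rewrite /MX_entry /= subSS subn0.
rewrite !modnMDl !divnMDl; try lia.
rewrite (modn_small tn) (modn_small sn) (divn_small tn) (divn_small sn) !addn0.
by rewrite !eqSS; case: eqP => // _; case: eqP => // <-.
Qed.

Lemma size_col_poly p : (p < n)%N -> (size (col_poly p) <= n)%N.
Proof.
move=> pn; apply: leq_trans (size_polyMleq _ _) _; rewrite size_exp_XsubC.
have := size_newton n w alpha (n - p.+1)%N; move: (size _) => z; lia.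
Qed.

Lemma theta_op_col a p : (p < n)%N ->
  theta_op n w a (col_poly p)
  = row_poly p + (alpha (n - p)%N - a)%:P * row_poly p.+1.
Proof.
move=> pn; rewrite /col_poly theta_op_newton; last by lia.
by rewrite /row_poly -subSn // subSS.
Qed.

Lemma row_block_col r t p s : (r < n.+1)%N -> (t < n.-1)%N -> (p < n)%N -> (s < n)%N ->
  \sum_(0 <= l < n) MX_entry k X1 X2 Y (r * n.-1 + t).+1 (l * n + s) * (col_poly p)`_l
  = if s == t then 4 * Y t.+1 * (theta_op n w (alpha t.+1) (col_poly p))`_r
    else if s == t.+1 then - Y t.+1 * (theta_op n w (beta t.+1) (col_poly p))`_r
    else 0.
Proof.
move=> rn tn pn sn.
(* The last block row has no block F; the term it would contribute carries this coefficient, hence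
   vanishes. *)
have Pn : (col_poly p)`_n = 0 by apply/leq_sizeP: (size_col_poly pn).
under eq_bigr => l _ do rewrite MX_entry_block //.
transitivity (F_entry k X1 X2 Y r.+1 t.+1 s.+1 * (col_poly p)`_r
   + if r is i.+1 then G_entry k X1 X2 Y r t.+1 s.+1 * (col_poly p)`_i else 0).
  pose fl l := F_entry k X1 X2 Y r.+1 t.+1 s.+1 * (col_poly p)`_l.
  pose gl l := G_entry k X1 X2 Y r t.+1 s.+1 * (col_poly p)`_l.
  transitivity (\sum_(0 <= l < n) (if l == r then fl l else 0)
    + \sum_(0 <= l < n) (if l.+1 == r then gl l else 0)); rewrite {}/fl {}/gl.
    rewrite -big_split; apply: eq_bigr => l _ /=.
    case: eqP => [->|_]; last by rewrite add0r; case: eqP; rewrite ?mul0r.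
    by rewrite (gtn_eqF (ltnSn _)) addr0.
  congr (_ + _).
    rewrite -big_mkcond big_nat1_eq /=; case: (ltnP r n) => // nr.
    by rewrite (_ : r = n) ?Pn ?mulr0 //; lia.
  case: r rn => [|r] rn; first by rewrite big1.
  by rewrite -big_mkcond big_nat1_eq /= -ltnS rn.
have two0 : (2 : K) != 0 by exact: (nat_neq0 1).
have Y0 := Y_neq0 t.+1.
rewrite !coef_theta_op /F_entry /G_entry !eqSS /f0 /f1 /g0 /g1 /alpha /beta /Nk.
case: (s == t); [|case: (s == t.+1)] => /=; case: r rn => [|r] rn;
  rewrite ?mul0r ?addr0 // ?subn1 ?addn1 /= ?(natrD, natrM) -?[_.+1%:R]natr1
    ?(natrD, natrM); field; rewrite ?Y0 ?two0 //.
Qed.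

(** Row (R, t) of the left side extracts the coefficient of index R of Theta applied to
    [col_poly p]. By [theta_op_col] this is a combination of [row_poly p] and [row_poly p.+1], whose
    weights are the entries of [sparse_mx]. *)
Lemma MX_col_basis : MX k X1 X2 Y *m col_basis_mx = row_basis_mx *m sparse_mx.
Proof.
have n_gt0 : (0 < n)%N by lia.
have n1_gt0 : (0 < n.-1)%N by lia.
apply/matrixP => r d; rewrite !mxE.
pose f c := MX_entry k X1 X2 Y r c * (if (c %% n == d %% n)%N
   then (col_poly (d %/ n))`_(c %/ n) else 0).
pose g q := (if row_cls r == row_cls q
   then (('X - w%:P) ^+ row_lev q * row_newton q)`_(row_lev r) else 0)
   * sparse_entry q d.
transitivity (\sum_(0 <= c < N) f c).
  by rewrite big_mkord; apply: eq_bigr => c _; rewrite !mxE.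
transitivity (\sum_(0 <= q < N) g q); last first.
  by rewrite big_mkord; apply: eq_bigr => q _; rewrite !mxE.
rewrite {}/f {}/g.
move: (nat_of_ord r) (ltn_ord r) (nat_of_ord d) (ltn_ord d) => {}r rN {}d dN.
set p := (d %/ n)%N; set s := (d %% n)%N.
have sn : (s < n)%N by rewrite ltn_mod.
have pn : (p < n)%N by rewrite ltn_divLR // -size_MX_cols.
transitivity (\sum_(0 <= l < n) MX_entry k X1 X2 Y r (l * n + s) * (col_poly p)`_l).
  under eq_bigr => c _ do rewrite [_ * _]fun_if mulr0.
  rewrite size_MX_cols sum_residue //; apply: eq_bigr => l _.
  by rewrite divnMDl // (divn_small sn) addn0.
rewrite [in RHS]size_MX_rows [in RHS]big_ltn // [in RHS]big_add1 /=.
case: r rN => [|r] rN.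
  rewrite /row_cls /row_lev /row_newton /= mul1r coefC /= mul1r.
  rewrite [X in _ = _ + X]big1 => [|q _]; last by rewrite mul0r.
  rewrite addr0 /sparse_entry /= -/p -/s /MX_entry /=.
  under eq_big_nat => l /andP[_ ln] do
    rewrite modnMDl modn_small // divnMDl // (divn_small sn) addn0.
  rewrite /x_entry; case: eqP => _; last by rewrite big1 // => l _; rewrite mul0r.
  by rewrite big_mkord.
rewrite {1}/row_cls /= mul0r add0r.
have rE := divn_eq r n.-1.
set R := (r %/ n.-1)%N in rE; set t := (r %% n.-1)%N in rE.
have tn : (t < n.-1)%N by rewrite ltn_mod.
have Rn : (R < n.+1)%N by rewrite ltn_divLR //; move: rN; rewrite size_MX_rows.
rewrite rE row_block_col //.
under eq_big_nat => q _ do rewrite /row_cls /row_lev /row_newton /= !subSS !subn0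
  modnMDl (modn_small tn) divnMDl // (divn_small tn) addn0 eqSS eq_sym.
pose f q := (row_poly (q %/ n.-1))`_R * sparse_entry q.+1 d.
transitivity (\sum_(0 <= q < n.+1 * n.-1) (if (q %% n.-1 == t)%N then f q else 0)).
  2: by apply: eq_bigr => q _; rewrite /f /row_poly /row_lev /= subSS subn0;
        case: ifP; rewrite ?mul0r.
rewrite sum_residue // /f {f}.
have pick (a b : K) :
  \sum_(0 <= q < n.+1) (row_poly q)`_R * (a * ((q == p)%:R + (q == p.+1)%:R * b))
  = a * ((row_poly p)`_R + b * (row_poly p.+1)`_R).
  transitivity (\sum_(0 <= q < n.+1 | q == p) a * (row_poly q)`_R
    + \sum_(0 <= q < n.+1 | q == p.+1) a * b * (row_poly q)`_R).
    rewrite !(big_mkcond (fun q => q == _)) -big_split; apply: eq_bigr => q _ /=.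
    by case: eqP => _; case: eqP => _; rewrite ?mulr0n ?mulr1n; ring.
  by rewrite !big_nat1_eq /= !ifT ?ltnS // 1?ltnW //; ring.
under eq_big_nat => q _.
  rewrite divnMDl // (divn_small tn) addn0 /sparse_entry /= subSS subn0.
  rewrite divnMDl // (divn_small tn) addn0 modnMDl (modn_small tn) -/p -/s !eqSS.
  over.
rewrite !theta_op_col //.
case: (s == t); [|case: (s == t.+1)]; rewrite ?pick ?coefD ?coefCM //.
by rewrite big1 // => q _; rewrite mulr0.
Qed.



End Factorization.

(** * Determinants of the changes of basis *)

(** The value at [w] of a Newton product with [j] factors, as in [newton_at_pole]. *)
Definition pole_value (K : fieldType) (k j : nat) : K :=
  (- ((4 * k)%N%:R * (-4) ^+ k)) ^+ j * (j.+1)`!%:R.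

Section Det.

Variables (K : fieldType) (k : nat).
Hypothesis k_gt0 : (0 < k)%N.
Variables X1 Y : nat -> K.

Local Notation n := (4 * k)%N.
Local Notation N := (16 * k ^ 2)%N.
Local Notation w := ((-4) ^+ k : K).
Local Notation alpha := (alpha k X1 Y).

(** Each number of factors below [n] occurs once for each of the [n] positions in a block column. *)
Lemma det_col_basis :
  \det (col_basis_mx k X1 Y) = (\prod_(0 <= j < n) pole_value K k j) ^+ n.
Proof.
have n_gt0 : (0 < n)%N by lia.
rewrite /col_basis_mx (@det_coef_basis K N (fun c => c %% n)%N (fun c => c %/ n)%N w
   (fun d => newton n w alpha (n - (d %/ n).+1)%N)).
- pose F d := (newton n w alpha (n - (d %/ n).+1)%N).[w].
  rewrite -(big_mkord xpredT F) [X in index_iota _ X]size_MX_cols big_nat_blocks.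
  rewrite -prodrXl [in RHS]big_nat_rev /=; apply: eq_big_nat => p /andP[_ pn].
  rewrite add0n -[X in _ ^+ X]subn0 -prodr_const_nat; apply: eq_big_nat => s sn.
  by rewrite /F divnMDl // divn_small // addn0 newton_at_pole.
- move=> c d cd; rewrite leq_eqVlt => /orP[/eqP lcd|lt].
    by rewrite (divn_eq c n) cd lcd -divn_eq.
  rewrite (divn_eq c n) (divn_eq d n) cd leq_add2r leq_mul2r; lia.
- move=> d l ld.
  have dn : (d %/ n < n)%N by rewrite ltn_divLR // -size_MX_cols.
  have ln : (l < n)%N.
    have := size_newton n w alpha (n - (d %/ n).+1); move: (size _) ld => z; lia.
  have mn : (d %% n < n)%N by rewrite ltn_mod.
  have cN : (l * n + d %% n < N)%N.
    by apply: (@leq_trans (n * n)); [nia | rewrite size_MX_cols].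
  exists (Ordinal cN) => /=; rewrite modnMDl modn_mod; split=> //.
  by rewrite divnMDl // (divn_small mn) addn0.
Qed.

(** Each number of factors from 0 to [n] occurs once for each of the [n.-1] rows of a block; the
    first row contributes 1. *)
Lemma det_row_basis :
  \det (row_basis_mx k X1 Y) = (\prod_(0 <= j < n.+1) pole_value K k j) ^+ n.-1.
Proof.
have n1_gt0 : (0 < n.-1)%N by lia.
rewrite /row_basis_mx (@det_coef_basis K N (row_cls k) (row_lev k) w
   (row_newton k X1 Y)).
- pose F r := (row_newton k X1 Y r).[w].
  rewrite -(big_mkord xpredT F) [X in index_iota _ X]size_MX_rows //.
  rewrite big_ltn // big_add1 /= {1}/F /row_newton /= hornerC mul1r big_nat_blocks.
  rewrite -prodrXl [in RHS]big_nat_rev /=; apply: eq_big_nat => q /andP[_ qn].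
  rewrite add0n -[X in _ ^+ X]subn0 -prodr_const_nat; apply: eq_big_nat => t tn.
  rewrite /F /row_newton /row_lev /= !subSS !subn0.
  by rewrite divnMDl // divn_small // addn0 newton_at_pole.
- move=> [c cN] [d dN] /=; rewrite /row_cls /row_lev.
  case: c cN => [|c] //= cN; case: d dN => [|d] //= dN [].
  rewrite !subSS !subn0 ltnS => cd; rewrite leq_eqVlt => /orP[/eqP lcd|lt].
    by rewrite (divn_eq c n.-1) cd lcd -divn_eq.
  rewrite (divn_eq c n.-1) (divn_eq d n.-1) cd leq_add2r leq_mul2r; lia.
- move=> [d dN] l /=; rewrite /row_lev /row_newton /row_cls /row_lev.
  case: d dN => [|d] dN /=.
    by rewrite size_polyC oner_eq0 add0n ltnS leqn0 => /eqP ->; exists (Ordinal dN).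
  rewrite !subSS !subn0 => ld.
  have dn : (d %/ n.-1 < n.+1)%N.
    by rewrite ltn_divLR //; move: dN; rewrite size_MX_rows.
  have ln : (l < n.+1)%N.
    have := size_newton n w alpha (n - (d %/ n.-1)); move: (size _) ld => z; lia.
  have mn : (d %% n.-1 < n.-1)%N by rewrite ltn_mod.
  have cN : ((l * n.-1 + d %% n.-1).+1 < N)%N.
    by apply: (@leq_trans (n.+1 * n.-1).+1); [nia | rewrite size_MX_rows].
  exists (Ordinal cN) => /=; rewrite !subSS !subn0 modnMDl modn_mod; split=> //.
  by rewrite divnMDl // (divn_small mn) addn0.
Qed.

End Det.

(** * The permutation matching rows with columns, and its sign *)

Section Matching.

Variable n : nat.
Hypothesis n_gt1 : (1 < n)%N.

(* Up to a transposition, the matching of rows with columns rotates each block of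
   n - 1 rows; as n - 1 is odd, such rotations are even. *)
Definition rot_row (r : nat) : nat :=
  if r == 0%N then 0%N
  else ((r - 1) %/ n.-1 * n.-1
        + ((r - 1) %% n.-1 + ((r - 1) %/ n.-1 + n.-2)) %% n.-1).+1.

(** Row (q, t) takes its entry [4 * Y t.+1] if [q + t < n], and otherwise its entry containing a
    difference of an alpha and a beta. In the second case [t <= n - 2] forces [q >= 2], so [q.-1] is
    a true predecessor. *)
Definition matched_col (r : nat) : nat :=
  if r == 0%N then n.-1
  else let q := ((r - 1) %/ n.-1)%N in let t := ((r - 1) %% n.-1)%N in
    if (q + t < n)%N then (q * n + t)%N else (q.-1 * n + t.+1)%N.

Lemma rot_row_block q t : (t < n.-1)%N ->
  rot_row (q * n.-1 + t).+1 = (q * n.-1 + (t + (q + n.-2)) %% n.-1).+1.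
Proof.
move=> tn; rewrite /rot_row /= subSS subn0 modnMDl divnMDl; last by lia.
by rewrite (divn_small tn) (modn_small tn) addn0.
Qed.

Lemma matched_col_block q t : (t < n.-1)%N ->
  matched_col (q * n.-1 + t).+1
  = if (q + t < n)%N then (q * n + t)%N else (q.-1 * n + t.+1)%N.
Proof.
move=> tn; rewrite /matched_col /= subSS subn0 modnMDl divnMDl; last by lia.
by rewrite (divn_small tn) (modn_small tn) addn0.
Qed.

Lemma iter_rot_row i q t : (t < n.-1)%N ->
  iter i rot_row (q * n.-1 + t).+1 = (q * n.-1 + (t + i * (q + n.-2)) %% n.-1).+1.
Proof.
move=> tn; have n1_gt0 : (0 < n.-1)%N by lia.
elim: i => [|i IH] /=; first by rewrite mul0n addn0 modn_small.
rewrite IH rot_row_block ?ltn_mod // modnDml mulSn.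
by rewrite -addnA [(i * _ + _)%N]addnC.
Qed.

(** Modulo [n.-1] the number [n.-2] is -1, so the rotation is by [q - 1]. *)
Lemma rot_shift q t : (q < n.+1)%N -> (t < n.-1)%N ->
  ((t + (q + n.-2)) %% n.-1)%N
  = if (q + t == 0)%N then n.-2
    else if (q + t < n)%N then (q + t).-1 else (q + t - n)%N.
Proof.
move=> qn tn; case: eqP => [qt0|qt0].
  by rewrite addnA [(t + q)%N]addnC qt0 modn_small //; lia.
case: ifP => qtn.
  by rewrite (_ : (t + _ = (q + t).-1 + n.-1)%N) ?modnDr ?modn_small //; lia.
rewrite (_ : (t + _ = (q + t - n) + n.-1 + n.-1)%N); last by lia.
by rewrite !modnDr modn_small //; lia.
Qed.

Variable m : nat.
Hypothesis mE : m = (n.+1 * n.-1).+1.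

Lemma block_decomp r : (0 < r < m)%N ->
  exists q t, [/\ r = (q * n.-1 + t).+1, (q < n.+1)%N & (t < n.-1)%N].
Proof.
have n1_gt0 : (0 < n.-1)%N by lia.
case: r => // r; rewrite mE ltnS /= => rm.
exists (r %/ n.-1)%N, (r %% n.-1)%N; split; first by rewrite -divn_eq.
  by rewrite ltn_divLR.
by rewrite ltn_mod.
Qed.

Lemma rot_row_lt r : (r < m)%N -> (rot_row r < m)%N.
Proof.
case: r => [|r] // rm; have [q [t [-> qn tn]]] := block_decomp (rm : (0 < r.+1 < m)%N).
have n1_gt0 : (0 < n.-1)%N by lia.
rewrite rot_row_block // mE ltnS.
have := ltn_pmod (t + (q + n.-2)) n1_gt0; move: (_ %% _)%N => x xn.
by apply: (@leq_trans (q.+1 * n.-1)); [rewrite mulSn; lia | rewrite leq_mul2r qn orbT].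
Qed.

Lemma iter_rot_row_period r : (r < m)%N -> iter n.-1 rot_row r = r.
Proof.
case: r => [|r] rm; first by elim: n.-1 => //= i ->.
have [q [t [-> qn tn]]] := block_decomp (rm : (0 < r.+1 < m)%N).
by rewrite iter_rot_row // -modnDmr modnMr addn0 modn_small.
Qed.

Definition rot_ord (r : 'I_m) : 'I_m := Ordinal (rot_row_lt (ltn_ord r)).

Lemma iter_rot_ord i r : iter i rot_ord r = iter i rot_row r :> nat.
Proof. by elim: i => //= i ->. Qed.

Lemma rot_ord_inj : injective rot_ord.
Proof.
have n1E : n.-1 = n.-2.+1 by lia.
move=> r r' rr'; apply/val_inj => /=.
rewrite -[LHS]iter_rot_row_period // -[RHS]iter_rot_row_period //.
by rewrite -!iter_rot_ord n1E !iterSr rr'.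
Qed.

Lemma first_lt : (0 < m)%N. Proof. by rewrite mE. Qed.
Lemma last_lt : (n.-1 < m)%N. Proof. by rewrite mE ltnS mulSn leq_addr. Qed.

Definition matching : 'S_m :=
  (perm rot_ord_inj * tperm (Ordinal first_lt) (Ordinal last_lt))%g.

Lemma odd_matching : ~~ odd n -> matching = true :> bool.
Proof.
move=> n_even; rewrite odd_permM odd_tperm.
rewrite (@odd_perm_period _ n.-1); first by rewrite -val_eqE /=; lia.
  by lia.
move=> r; apply/val_inj; rewrite /= -[RHS]iter_rot_row_period //.
rewrite -iter_rot_ord; congr val; elim: n.-1 => //= i ->; by rewrite permE.
Qed.

(** In flat indices [q (n - 1) + (q + t - 1) + 1 = q n + t], and replacing [q + t - 1] by
    [q + t - n] gives [(q - 1) n + t + 1]: inside a block the matching is the rotation. The two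
    disagree only at the first row and at the row [q = t = 0], which the transposition of columns 0
    and [n.-1] corrects. *)
Lemma matchingE r : matching r = matched_col r :> nat.
Proof.
rewrite permM (_ : perm rot_ord_inj r = rot_ord r) ; last by rewrite permE.
case: (tpermP (Ordinal first_lt) (Ordinal last_lt) (rot_ord r))
  => [/(congr1 val)|/(congr1 val)|] /=.
- case: (nat_of_ord r) (ltn_ord r) => [|{}r] rm; first by rewrite /matched_col.
  have [q [t [-> qn tn]]] := block_decomp (rm : (0 < r.+1 < m)%N).
  by rewrite rot_row_block.
- case: (nat_of_ord r) (ltn_ord r) => [|{}r] rm.
    by rewrite /rot_row /=; lia.
  have [q [t [-> qn tn]]] := block_decomp (rm : (0 < r.+1 < m)%N).
  rewrite rot_row_block // rot_shift // matched_col_block // => E.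
  have q0 : q = 0%N.
    case: q qn E => // q qn; rewrite mulSn.
    by move: (q * _)%N (if _ then _ else _) => a b; lia.
  by move: E; rewrite q0 !mul0n !add0n; do 2?[case: ifP]; lia.
move=> /eqP; rewrite -val_eqE /= => r0 /eqP; rewrite -val_eqE /= => r1.
case: (nat_of_ord r) (ltn_ord r) r0 r1 => [|{}r] // rm.
have [q [t [-> qn tn]]] := block_decomp (rm : (0 < r.+1 < m)%N).
rewrite rot_row_block // rot_shift // matched_col_block // => _.
have nE : n = n.-1.+1 by lia.
case: q qn => [|q] qn; first by rewrite !mul0n !add0n; do 3?[case: ifP]; lia.
have -> : (q.+1 * n = q.+1 * n.-1 + q.+1)%N by rewrite {1}nE mulnS addnC.
have -> : (q.+1.-1 * n = q * n.-1 + q)%N by rewrite /= {1}nE mulnS addnC.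
by rewrite [(q.+1 * n.-1)%N]mulSn; move: (q * n.-1)%N => a; do 3?[case: ifP]; lia.
Qed.

End Matching.

(** * Determinant of the sparse matrix *)

Section SparseDet.

Variables (K : fieldType) (k : nat).
Hypothesis k_gt0 : (0 < k)%N.
Variables X1 X2 Y : nat -> K.

Local Notation n := (4 * k)%N.
Local Notation N := (16 * k ^ 2)%N.
Local Notation alpha := (alpha k X1 Y).
Local Notation beta := (beta k X2 Y).

(* A column with j + 1 < s is matched with the row (s - 1, j), the others with the
   row (s, j + 1); the former are eliminated first, by increasing s + j, then the
   latter, by decreasing s + j. *)
Definition col_rank c :=
  let j := (n - (c %/ n).+1)%N in let s := (c %% n).+1 in
  if (j.+1 < s)%N then (s + j)%N else (4 * n - (s + j))%N.

Lemma col_rank_block p s : (s < n)%N ->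
  col_rank (p * n + s)
  = if ((n - p.+1).+1 < s.+1)%N then (s.+1 + (n - p.+1))%N
    else (4 * n - (s.+1 + (n - p.+1)))%N.
Proof.
move=> sn; rewrite /col_rank modnMDl divnMDl; last by lia.
by rewrite (divn_small sn) (modn_small sn) addn0.
Qed.

Lemma sparse_entry_block q t p s : (t < n.-1)%N -> (s < n)%N ->
  sparse_entry k X1 X2 Y (q * n.-1 + t).+1 (p * n + s)
  = if s == t then 4 * Y t.+1 * ((q == p)%:R + (q == p.+1)%:R
                      * (alpha (n - p)%N - alpha t.+1))
    else if s == t.+1 then
      - Y t.+1 * ((q == p)%:R + (q == p.+1)%:R * (alpha (n - p)%N - beta t.+1))
    else 0.
Proof.
move=> tn sn; rewrite /sparse_entry /= subSS subn0 !modnMDl !divnMDl; try lia.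
by rewrite (divn_small tn) (modn_small tn) (divn_small sn) (modn_small sn) !addn0 !eqSS.
Qed.

Lemma sparse_entry_rank r c : (r < N)%N -> (c < N)%N ->
  sparse_entry k X1 X2 Y r c != 0 -> c != matched_col n r ->
  (col_rank c < col_rank (matched_col n r))%N.
Proof.
have n_gt0 : (0 < n)%N by lia.
have n_gt1 : (1 < n)%N by lia.
move=> rN cN.
have [p [s [cE pn sn]]] : exists p s, [/\ c = p * n + s, p < n & s < n]%N.
  exists (c %/ n)%N, (c %% n)%N; split; first exact: divn_eq.
    by rewrite ltn_divLR // -size_MX_cols.
  by rewrite ltn_mod.
subst c; clear cN; have [->|r_gt0] := posnP r.
  rewrite /matched_col /= -[n.-1](add0n n.-1) -[X in (X + n.-1)%N](mul0n n).
  rewrite !col_rank_block; try lia.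
  rewrite /sparse_entry /= modnMDl (modn_small sn).
  case: (eqVneq s.+1 n) => [sE _ pE|]; last by rewrite eqxx.
  have p0 : (0 < p)%N by rewrite lt0n; apply: contraNneq pE => ->; apply/eqP; lia.
  by do 2?[case: ifP]; lia.
have [q [t [-> qn tn]]] :=
  block_decomp n_gt1 (size_MX_rows k_gt0) (introT andP (conj r_gt0 rN)).
rewrite sparse_entry_block // matched_col_block //.
case: (eqVneq s t) => [->|st]; last case: (eqVneq s t.+1) => [->|st'];
  last by rewrite eqxx.
  case: (eqVneq q p) => [qp|qp].
    subst p; case: ifP => qt; first by rewrite eqxx.
    case: q qn qt pn => [|q] qn qt pn; first by lia.
    by move=> _ _; rewrite !col_rank_block; try lia; do 2?[case: ifP]; lia.
  case: (eqVneq q p.+1) => [qp1 + _|_]; last by rewrite mul0r addr0 mulr0 eqxx.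
  subst q.
  (* At [n - p = t + 1] the ranks are in the wrong order, but the entry is a difference of equal
     alphas, hence zero. *)
  have [->|npt _] := eqVneq (n - p)%N t.+1.
    by rewrite subrr mulr0 addr0 mulr0 eqxx.
  by case: ifP => qt; rewrite !col_rank_block; try lia; do 2?[case: ifP]; lia.
case: (eqVneq q p) => [qp|qp].
  subst p; case: ifP => qt _; last case: q qn qt pn => [|q] qn qt pn; try lia.
    by rewrite !col_rank_block; try lia; do 2?[case: ifP]; lia.
  by move=> _; rewrite !col_rank_block; try lia; do 2?[case: ifP]; lia.
case: (eqVneq q p.+1) => [qp1 _|_]; last by rewrite mul0r addr0 mulr0 eqxx.
subst q; case: ifP => qt; last by rewrite eqxx.
by rewrite !col_rank_block; try lia; do 2?[case: ifP]; lia.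
Qed.

Lemma det_sparse_mx :
  \det (sparse_mx k X1 X2 Y)
  = - (u_form k (col_poly k X1 Y 0)
       * \prod_(1 <= t < n) ((4 * Y t) ^+ (n.+1 - t)
                             * \prod_(1 <= a < t.+1) (Y t * (beta t - alpha a)))).
Proof.
have n_gt1 : (1 < n)%N by lia.
rewrite (det_matching (s := matching n_gt1 (size_MX_rows k_gt0))
  (rk := fun c => col_rank c)); last first.
  move=> r c; rewrite mxE -val_eqE /= matchingE => *.
  exact: sparse_entry_rank.
rewrite odd_matching ?oddM // expr1 mulN1r; congr (- _).
pose F r := sparse_entry k X1 X2 Y r (matched_col n r).
under eq_bigr => r _ do rewrite mxE matchingE -/(F r).
rewrite -(big_mkord xpredT F) size_MX_rows // big_ltn // big_add1 /= big_nat_blocks.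
congr (_ * _).
  rewrite /F /matched_col /sparse_entry /= modn_small ?divn_small; try lia.
  by rewrite prednK ?eqxx //; lia.
rewrite exchange_big big_add1 /=; apply: eq_big_nat => t /andP[_ tn].
(* For fixed [t] the first [n - t] blocks give [4 * Y t.+1]; the other [t + 1], read backwards, give
   the nodes [alpha a] with [a] from 1 to [t + 1]. *)
rewrite (@big_cat_nat _ _ _ (n - t)%N) //=; try lia.
congr (_ * _).
  rewrite -[X in _ ^+ X]subn0 -prodr_const_nat; apply: eq_big_nat => q /andP[_ qn].
  rewrite /F matched_col_block // ifT; last by lia.
  rewrite sparse_entry_block; try lia.
  by rewrite !eqxx (ltn_eqF (ltnSn q)) mul0r addr0 mulr1.
rewrite -{1}[(n - t)%N]add0n big_addn big_nat_rev big_add1 /=.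
rewrite (_ : (n.+1 - (n - t) = t.+1)%N); last by lia.
apply: eq_big_nat => a /andP[_ an].
rewrite /F matched_col_block // ifF; last by lia.
rewrite sparse_entry_block; try lia.
rewrite (gtn_eqF (ltnSn t)) eqxx.
rewrite gtn_eqF; last by lia.
rewrite prednK; last by lia.
rewrite eqxx add0r mul1r.
rewrite (_ : (n - _ = a.+1)%N); last by lia.
ring.
Qed.

End SparseDet.

(** * Evaluation of the first row and of the linear factors *)

Section Evaluation.

Variables (K : fieldType) (k : nat).
Hypothesis k_gt0 : (0 < k)%N.
Variables X1 X2 Y : nat -> K.
Hypothesis Y_neq0 : forall t, Y t != 0.
Hypothesis nat_neq0 : forall m, m.+1%:R != 0 :> K.

Local Notation n := (4 * k)%N.
Local Notation w := ((-4) ^+ k : K).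
Local Notation alpha := (alpha k X1 Y).
Local Notation beta := (beta k X2 Y).

Lemma u_rising l : (l < n)%N ->
  u K k l.+1 = (-1) ^+ l * w ^+ l.+2 * (2 * n%:R * n.+1%:R)
    * (\prod_(0 <= i < n.-1 - l) (n%:R * i%:R + (n%:R - 1))
       * \prod_(0 <= i < l) (n%:R * i%:R + (n%:R + 1))).
Proof.
move=> ln; rewrite /u subSS subn0 addn1 -exprM [(k * _)%N]mulnC -!mulrA.
congr (_ * (_ * _)); rewrite !mulrA; congr (_ * _ * _).
- by rewrite -!natrM; congr _%:R; lia.
- rewrite big_add1 /= (_ : (n - l.+1 = n.-1 - l)%N); last by lia.
  apply: eq_bigr => i _; rewrite natrB; last by lia.
  by rewrite (_ : (4 * i.+1 * k = n * i + n)%N) ?natrD ?natrM; [ring | lia].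
- rewrite big_add1 /=; apply: eq_bigr => i _.
  by rewrite (_ : (4 * i.+1 * k = n * i + n)%N) ?natrD ?natrM; [ring | lia].
Qed.

(** From [l] to [l + 1] the first product loses the factor [n (n - 1 - l) - 1 = - (n (l + 1 - n) +
    1)], whose sign is that of [(-1) ^+ l], and the second gains [n (l + 1) + 1]. *)
Lemma u_rec l : (l.+1 < n)%N ->
  u K k l.+2 * (n%:R * (l.+1%:R - n%:R) + 1) = w * (n * l.+1 + 1)%:R * u K k l.+1.
Proof.
move=> ln; rewrite !u_rising //; last by lia.
rewrite big_nat_recr // (_ : (n.-1 - l = (n.-1 - l.+1).+1)%N); last by lia.
rewrite [in RHS]big_nat_recr //=.
have -> : (n.-1 - l.+1)%:R = n%:R - 1 - l.+1%:R :> K.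
  by rewrite natrB; [rewrite -[in RHS](prednK (n := n)) ?natrS //; [ring | lia] | lia].
rewrite natrD natrM -[l.+1%:R]natr1 !exprS; ring.
Qed.

(** In the binomial expansion all powers of [w] combine to [w ^+ n.+1] and all signs to
    [(-1) ^+ n.-1]. The Vandermonde convolution sums the rest to the product of the [n i + 2 n]. *)
Lemma u_form_last :
  u_form k (('X - w%:P) ^+ n.-1)
  = (-1) ^+ n.-1 * w ^+ n.+1 * (2 * n%:R * n.+1%:R) * (n%:R ^+ n.-1 * n`!%:R).
Proof.
have nE : n = n.-1.+1 by lia.
have powE m : ('X - w%:P) ^+ m = \poly_(i < m.+1) ('C(m, i)%:R * (- w) ^+ (m - i)).
  rewrite addrC exprDn poly_def; apply: eq_bigr => i _.
  by rewrite -polyCN -polyC_exp -mul_polyC -mulr_natl mulrA polyCM polyC_natr.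
transitivity ((-1) ^+ n.-1 * w ^+ n.+1 * (2 * n%:R * n.+1%:R)
   * \prod_(0 <= i < n.-1) (n%:R * i%:R + ((n%:R - 1) + (n%:R + 1))) : K).
  rewrite -prod_rising_vandermonde mulr_sumr /u_form /row_form powE.
  rewrite [in LHS]nE; apply: eq_bigr => l _.
  have ln : (l < n)%N by rewrite [X in (_ < X)%N]nE.
  rewrite coef_poly ltn_ord u_rising // [(- w) ^+ _]exprNn.
  have -> : (-1) ^+ n.-1 = (-1) ^+ l * (-1) ^+ (n.-1 - l) :> K.
    by rewrite -exprD; congr (_ ^+ _); lia.
  have -> : w ^+ n.+1 = w ^+ l.+2 * w ^+ (n.-1 - l).
    by rewrite -exprD; congr (_ ^+ _); lia.
  ring.
congr (_ * _).
have -> : n`! = (n.-1).+1`! by rewrite -nE.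
elim: n.-1 => [|m IH]; first by rewrite big_geq // mulr1.
rewrite big_nat_recr //= IH [in RHS]factS [(m.+2 * _)%:R]natrM exprS.
rewrite -[m.+2%:R]natr1 -[m.+1%:R]natr1; ring.
Qed.

Lemma u_form_first :
  u_form k (col_poly k X1 Y 0)
  = \prod_(1 <= a < n) (- (n.+1%:R + alpha a)) * u_form k (('X - w%:P) ^+ n.-1).
Proof.
rewrite /u_form /col_poly (@row_form_newton K n w alpha _ u_rec 0 (n - 1)); last by lia.
by rewrite -subSn ?subn1 //; lia.
Qed.

Local Notation L a := (2 * X1 a - (32 * k ^ 2 + 2 * a - 1)%:R * Y a).
Local Notation D a b :=
  (2 * X2 b * Y a - 2 * X1 a * Y b - (2 * b - 2 * a + 1)%:R * Y a * Y b).

(** Clearing denominators in the differences beta - alpha costs [(2 * Y a) ^- (n - a)]. Against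
    [(4 * Y a) ^+ (n.+1 - a)] this leaves [2 ^+ (n.+1 - a) * (2 * Y a)], and the last factor clears
    the denominator of [L a]. *)
Lemma det_sparse_factored :
  \det (sparse_mx k X1 X2 Y)
  = - (w ^+ n.+1 * (2 * n%:R * n.+1%:R) * (n%:R ^+ n.-1 * n`!%:R))
    * \prod_(1 <= t < n) 2 ^+ (n.+1 - t)
    * \prod_(1 <= a < n) L a
    * \prod_(1 <= a < n) \prod_(a <= b < n) D a b.
Proof.
have two0 : (2 : K) != 0 := nat_neq0 1.
have Lrw a : (1 <= a)%N -> - (n.+1%:R + alpha a) = -1 * (L a / (2 * Y a)).
  move=> a1; rewrite /alpha /Nk natrB ?natrD ?natrM ?natrX; last by lia.
  by rewrite -[n.+1%:R]natr1 natrM; field; rewrite two0 Y_neq0.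
have Drw a b : (a <= b)%N -> Y b * (beta b - alpha a) = (2 * Y a)^-1 * D a b.
  move=> ab; rewrite /alpha /beta -[b.+1%:R]natr1 natrD natrB ?leq_mul // !natrM.
  by field; rewrite two0 !Y_neq0.
rewrite det_sparse_mx // u_form_first u_form_last.
rewrite (eq_big_nat _ _ (F2 := fun a => -1 * (L a / (2 * Y a)))); last first.
  by move=> a /andP[a1 _]; apply: Lrw.
rewrite big_split /= prodr_const_nat subn1.
rewrite [X in _ * X](_ : _ = \prod_(1 <= t < n) (2 ^+ (n.+1 - t) * (2 * Y t))
   * \prod_(1 <= a < n) \prod_(a <= b < n) D a b).
  have sgn2 : (-1) ^+ n.-1 * (-1) ^+ n.-1 = 1 :> K by rewrite -expr2 sqrr_sign.
  have P0 : \prod_(1 <= t < n) (2 * Y t) != 0.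
    by rewrite prodf_seq_neq0; apply/allP => t _; rewrite mulf_neq0.
  rewrite [\prod_(1 <= t < n) (_ * (2 * Y t))]big_split /= prodf_div.
  move: sgn2 P0.
  move: (\prod_(1 <= t < n) (2 * Y t)) ((-1) ^+ n.-1) => P sgn sgn2 P0.
  by rewrite -[RHS]mul1r -sgn2; field.
rewrite big_split /=.
transitivity (\prod_(1 <= t < n) (4 * Y t) ^+ (n.+1 - t)
   * \prod_(1 <= a < n) (((2 * Y a)^-1) ^+ (n - a) * \prod_(a <= b < n) D a b)).
  congr (_ * _).
  pose f a b := (2 * Y a)^-1 * D a b.
  transitivity (\prod_(1 <= b < n) \prod_(1 <= a < n | (a <= b)%N) f a b).
    apply: eq_big_nat => b /andP[b1 bn]; rewrite [RHS]big_mkcond /=.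
    rewrite [RHS](big_cat_nat (n := b.+1)) //=.
    rewrite [X in _ = _ * X]big1_seq ?mulr1 /=; last first.
      by move=> a; rewrite mem_index_iota => /andP[ba _]; rewrite leqNgt ba.
    apply: eq_big_nat => a /andP[a1 ab].
    by rewrite ltnS in ab; rewrite ab Drw.
  rewrite (exchange_big_dep_nat (fun a => true)) //=.
  apply: eq_big_nat => a /andP[a1 an].
  rewrite -prodr_const_nat -big_split /= [LHS]big_mkcond /=.
  rewrite (big_cat_nat (n := a)) //=; last by rewrite ltnW.
  rewrite [X in X * _]big1_seq ?mul1r /=; last first.
    by move=> b; rewrite mem_index_iota => /andP[_ ba]; rewrite leqNgt ba.
  by apply: eq_big_nat => b /andP[-> _].
rewrite big_split /= mulrA -big_split /=; congr (_ * _).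
apply: eq_big_nat => t /andP[_ tn]; rewrite subSn; last by lia.
rewrite !exprS (_ : 4 * Y t = 2 * (2 * Y t)); last by ring.
move: (2 * Y t) (mulf_neq0 two0 (Y_neq0 t)) => z z0.
by rewrite exprMn exprVn; field; apply: expf_neq0.
Qed.

End Evaluation.

(** * Collecting factorials and powers *)

Lemma shifted_fact_mul i p : (shifted_fact i.+1 p * i`! = (i + p)`!)%N.
Proof.
rewrite /shifted_fact; elim: p => [|p IH]; first by rewrite big_geq // mul1n addn0.
by rewrite big_nat_recr //= mulnAC IH addnS factS mulnC addSn.
Qed.

(** Each shifted factorial completes [i!] to [(m.+1)!]; this turns the factorials left by the basis
    determinants into those of the formula. *)
Lemma prod_shifted_fact m :
  (\prod_(1 <= i < m.+1) shifted_fact i.+1 (m - i + 1) * \prod_(0 <= j < m) (j.+1)`!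
   = (m.+1)`! ^ m)%N.
Proof.
rewrite big_add1 /= -big_split /= -[X in (_ ^ X)%N]subn0 -prod_nat_const_nat.
apply: eq_big_nat => i /andP[_ im]; rewrite shifted_fact_mul; congr (_`!); lia.
Qed.

Lemma sum_nat_lt m : ((\sum_(0 <= j < m) j) * 2 = m * m.-1)%N.
Proof.
elim: m => [|m IH]; first by rewrite big_geq.
by rewrite big_nat_recr //= mulnDl IH; case: m {IH} => //= m; lia.
Qed.

Lemma sum_nat_rev m : (0 < m)%N ->
  ((\sum_(1 <= t < m) (m.+1 - t)) * 2 + 2 = m * m.+1)%N.
Proof.
case: m => // m _.
rewrite big_nat_rev (eq_big_nat _ _ (F2 := S)) => [|t t_lt]; last by lia.
elim: m => [|m IH]; first by rewrite big_geq.
by rewrite big_nat_recr //= mulnDl addnAC IH; lia.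
Qed.

(** Since [e + n] and [T + 1] both equal [2 f], the right side is [- w * (w ^+ 2) ^+ f * n ^+ (2 f)
    * 2 ^+ (2 f)]. The sign [(-1) ^+ (k - 1)] comes from [- w]. *)
Lemma pole_power (K : fieldType) (k : nat) : (0 < k)%N ->
  let n := (4 * k)%N in let e := (2 * k * n.-1)%N in
  let T := (\sum_(1 <= t < n) (n.+1 - t))%N in
  (-1) ^+ (k - 1) * 4 ^+ (2 * k * (4 * k ^ 2 + 7 * k + 2))
    * k%:R ^+ (2 * k * (4 * k + 1))
  = (- (n%:R * (-4) ^+ k)) ^+ e * - ((-4) ^+ k ^+ n.+1 * (2 * n%:R ^+ n)) * 2 ^+ T :> K.
Proof.
move=> k_gt0 n e T; set w := (-4) ^+ k.
pose f := (k * n.+1)%N.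
have eE : (e + n = 2 * f)%N by rewrite /e /f /n; nia.
have TE : (T.+1 = 2 * f)%N by have := @sum_nat_rev n; rewrite -/T /f /n; lia.
have e2 : e = (2 * (k * n.-1))%N by rewrite /e mulnA.
have sqw : w ^+ 2 = 4 ^+ (2 * k) by rewrite /w -exprM mulnC exprM sqrrN -exprM.
have wE : - w = (-1) ^+ (k - 1) * 4 ^+ k.
  by rewrite /w exprNn -[in (-1) ^+ k](subnK k_gt0) addn1 exprS; ring.
have xE : (- (n%:R * w)) ^+ e = n%:R ^+ e * w ^+ e.
  by rewrite e2 exprM sqrrN -exprM exprMn.
rewrite xE.
transitivity (- w * (w ^+ 2) ^+ f * n%:R ^+ (2 * f) * 2 ^+ (2 * f)); last first.
  by rewrite -exprM -{1 2}eE -TE !(exprD _ e n) !exprS; ring.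
rewrite wE sqw natrM exprMn [2 ^+ (2 * f)]exprM.
have -> : 2 ^+ 2 = 4 :> K by rewrite -natrX.
rewrite -[in RHS]exprM.
have -> : (2 * k * (4 * k + 1) = 2 * f)%N by rewrite /f /n; lia.
have -> : (2 * k * (4 * k ^ 2 + 7 * k + 2) = k + 2 * k * f + 2 * f + f)%N.
  by rewrite /f /n; ring.
rewrite !exprD; ring.
Qed.

(** * The formula over a field of characteristic zero *)

Section FieldCase.

Variables (K : fieldType) (k : nat).
Hypothesis k_gt0 : (0 < k)%N.
Variables X1 X2 Y : nat -> K.
Hypothesis Y_neq0 : forall t, Y t != 0.
Hypothesis nat_neq0 : forall m, m.+1%:R != 0 :> K.

Local Notation n := (4 * k)%N.
Local Notation w := ((-4) ^+ k : K).

Lemma pole_value_prod :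
  \prod_(0 <= j < n) pole_value K k j
  = (- (n%:R * w)) ^+ (2 * k * n.-1) * (\prod_(0 <= j < n) (j.+1)`!)%:R.
Proof.
rewrite /pole_value big_split /= prodrXr natr_prod; congr (_ ^+ _ * _).
have := sum_nat_lt n; lia.
Qed.

Lemma pole_value_neq0 j : pole_value K k j != 0.
Proof.
have natn0 m : (0 < m)%N -> m%:R != 0 :> K by case: m => // m _; apply: nat_neq0.
rewrite /pole_value mulf_neq0 ?natn0 ?fact_gt0 // expf_neq0 // oppr_eq0 mulf_neq0 //.
  by rewrite natn0 //; lia.
by rewrite expf_neq0 // oppr_eq0 natn0.
Qed.

Lemma det_MX_field :
  \det (MX k X1 X2 Y) =
    (-1) ^+ (k - 1) * 4 ^+ (2 * k * (4 * k ^ 2 + 7 * k + 2))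
    * (k%:R) ^+ (2 * k * (4 * k + 1))
    * (\prod_(1 <= i < (4 * k).+1) (shifted_fact i.+1 (4 * k - i + 1))%:R)
    * (\prod_(1 <= a < 4 * k)
         (2 * X1 a - (32 * k ^ 2 + 2 * a - 1)%:R * Y a))
    * (\prod_(1 <= a < 4 * k) \prod_(a <= b < 4 * k)
         (2 * X2 b * Y a - 2 * X1 a * Y b - (2 * b - 2 * a + 1)%:R * Y a * Y b)).
Proof.
have nE : n = n.-1.+1 by lia.
have := congr1 determinant (MX_col_basis k_gt0 X1 X2 Y_neq0 nat_neq0).
rewrite !det_mulmx det_col_basis // det_row_basis // det_sparse_factored //.
rewrite big_nat_recr //=.
have P0 : \prod_(0 <= j < n) pole_value K k j != 0.
  by rewrite prodf_seq_neq0; apply/allP => j _; apply: pole_value_neq0.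
move=> detE; apply: (mulIf (expf_neq0 n P0)); rewrite {}detE.
rewrite exprMn [X in _ = _ * _ ^+ X]nE [_ ^+ n.-1.+1]exprS.
move: (\prod_(1 <= a < n) (_ - _)) (\prod_(1 <= a < n) \prod_(_ <= b < n) _) => A B.
(* The basis determinants share the power [n.-1] of the product of the first [n] pole values; one
   more such product remains to be divided out, here written on the right. *)
have const : pole_value K k n ^+ n.-1
    * - (w ^+ n.+1 * (2 * n%:R * n.+1%:R) * (n%:R ^+ n.-1 * n`!%:R))
    * \prod_(1 <= t < n) 2 ^+ (n.+1 - t)
  = (-1) ^+ (k - 1) * 4 ^+ (2 * k * (4 * k ^ 2 + 7 * k + 2))
    * (k%:R) ^+ (2 * k * (4 * k + 1))
    * (\prod_(1 <= i < n.+1) (shifted_fact i.+1 (n - i + 1))%:R)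
    * \prod_(0 <= j < n) pole_value K k j.
  rewrite pole_power // pole_value_prod prodrXr -natr_prod.
  set x := - (n%:R * w).
  have := congr1 (fun m => m%:R : K) (prod_shifted_fact n).
  rewrite natrM natrX => factE.
  transitivity (x ^+ (n * n.-1) * (n.+1)`!%:R ^+ n
      * - (w ^+ n.+1 * (2 * n%:R ^+ n)) * 2 ^+ (\sum_(1 <= t < n) (n.+1 - t)%N)).
    have -> : (n.+1)`!%:R ^+ n = (n.+1)`!%:R ^+ n.-1 * (n.+1%:R * n`!%:R) :> K.
      by rewrite -natrM -factS -exprSr -nE.
    have -> : n%:R ^+ n = n%:R * n%:R ^+ n.-1 :> K by rewrite -exprS -nE.
    rewrite /pole_value -/x exprMn -exprM; ring.
  rewrite -factE (_ : (n * n.-1 = 2 * k * n.-1 + 2 * k * n.-1)%N); last by lia.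
  rewrite exprD; ring.
transitivity ((\prod_(0 <= j < n) pole_value K k j) ^+ n.-1
  * (pole_value K k n ^+ n.-1
    * - (w ^+ n.+1 * (2 * n%:R * n.+1%:R) * (n%:R ^+ n.-1 * n`!%:R))
    * \prod_(1 <= t < n) 2 ^+ (n.+1 - t)) * A * B); first by ring.
rewrite const; ring.
Qed.

End FieldCase.

(** * Transfer to arbitrary commutative rings *)

Definition det_value (R : comNzRingType) (k : nat) (X1 X2 Y : nat -> R) : R :=
  (-1) ^+ (k - 1) * 4 ^+ (2 * k * (4 * k ^ 2 + 7 * k + 2))
    * (k%:R) ^+ (2 * k * (4 * k + 1))
    * (\prod_(1 <= i < (4 * k).+1) (shifted_fact i.+1 (4 * k - i + 1))%:R)
    * (\prod_(1 <= a < 4 * k)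
         (2 * X1 a - (32 * k ^ 2 + 2 * a - 1)%:R * Y a))
    * (\prod_(1 <= a < 4 * k) \prod_(a <= b < 4 * k)
         (2 * X2 b * Y a - 2 * X1 a * Y b - (2 * b - 2 * a + 1)%:R * Y a * Y b)).

Section Transfer.

Variables (R S : comNzRingType) (phi : {rmorphism R -> S}) (k : nat).
Hypothesis k_gt0 : (0 < k)%N.
Variables (X1 X2 Y : nat -> R) (X1' X2' Y' : nat -> S).
Hypothesis X1E : forall t, (t < 4 * k)%N -> phi (X1 t) = X1' t.
Hypothesis X2E : forall t, (t < 4 * k)%N -> phi (X2 t) = X2' t.
Hypothesis YE : forall t, (t < 4 * k)%N -> phi (Y t) = Y' t.

Let rmE := (rmorphB, rmorphM, rmorphN, rmorphXn, rmorph_nat, rmorph0, rmorph1).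

Lemma rmorph_MX : map_mx phi (MX k X1 X2 Y) = MX k X1' X2' Y'.
Proof.
apply/matrixP => r c; rewrite !mxE /MX_entry.
(* The indeterminates are read only at indices below [4 * k], where the images under [phi] are
   prescribed. *)
have tn : (((r - 1) %% (4 * k).-1).+1 < 4 * k)%N.
  have : ((r - 1) %% (4 * k).-1 < (4 * k).-1)%N by rewrite ltn_mod; lia.
  lia.
rewrite /x_entry /u /F_entry /G_entry /f0 /f1 /g0 /g1.
case: ifP => _.
  case: ifP => _; rewrite !rmE // !rmorph_prod.
  by congr (_ * _ * _); apply: eq_bigr => i _; rewrite rmorph_nat.
by do 2?[case: ifP => _]; do ?[case: ifP => _]; rewrite ?rmE ?X1E ?X2E ?YE.
Qed.

Lemma rmorph_det_value : phi (det_value k X1 X2 Y) = det_value k X1' X2' Y'.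
Proof.
rewrite /det_value !rmE !rmorph_prod.
congr (_ * _ * _ * _).
- by apply: eq_bigr => i _; rewrite rmorph_nat.
- by apply: eq_big_nat => a /andP[_ an]; rewrite !rmE X1E ?YE.
apply: eq_big_nat => a /andP[_ an]; rewrite rmorph_prod.
by apply: eq_big_nat => b /andP[_ bn]; rewrite !rmE X1E ?X2E ?YE.
Qed.

End Transfer.

(* Both sides are specialisations of polynomials with integer coefficients, so
   the field of fractions of a polynomial ring is the only case needed. *)
Theorem theorem2 (R : comNzRingType) (k : nat) (hk : (1 <= k)%N)
    (X1 X2 Y : nat -> R) :
  \det (MX k X1 X2 Y) =
    (-1) ^+ (k - 1) * 4 ^+ (2 * k * (4 * k ^ 2 + 7 * k + 2))
    * (k%:R) ^+ (2 * k * (4 * k + 1))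
    * (\prod_(1 <= i < (4 * k).+1) (shifted_fact i.+1 (4 * k - i + 1))%:R)
    * (\prod_(1 <= a < 4 * k)
         (2 * X1 a - (32 * k ^ 2 + 2 * a - 1)%:R * Y a))
    * (\prod_(1 <= a < 4 * k) \prod_(a <= b < 4 * k)
         (2 * X2 b * Y a - 2 * X1 a * Y b - (2 * b - 2 * a + 1)%:R * Y a * Y b)).
Proof.
rewrite -/(det_value k X1 X2 Y).
pose n := (4 * k)%N; pose A := {mpoly int[(3 * n).+1]}.
(* [d = 0, 1, 2] stands for [X1], [X2], [Y]. Out of range [inord] falls back on the index 0, so
   [x d t] is a nonzero variable for every [t], as [det_MX_field] asks of [Y]. *)
pose x d t : A := 'X_(inord (d * n + t)).
have x_neq0 d t : x d t != 0.
  apply/eqP => /(congr1 (mcoeff U_(inord (d * n + t)))) /eqP.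
  by rewrite mcoeffX mcoeff0 eqxx.
have generic : \det (MX k (x 0) (x 1) (x 2)) = det_value k (x 0) (x 1) (x 2) :> A.
  apply/eqP; rewrite -tofrac_eq -det_map_mx; apply/eqP.
  pose y d t : {fraction A} := tofrac (x d t).
  rewrite (rmorph_MX hk (X1' := y 0) (X2' := y 1) (Y' := y 2)) //.
  rewrite (rmorph_det_value (X1' := y 0) (X2' := y 1) (Y' := y 2)) //.
  apply: det_MX_field => // [t|m]; first by rewrite tofrac_eq0.
  rewrite -[m.+1%:R](rmorph_nat (@tofrac A)) tofrac_eq0.
  by rewrite -(rmorph_nat (@mpolyC _ int)) mpolyC_eq0 Num.Theory.pnatr_eq0.
pose h (i : 'I_(3 * n).+1) : R :=
  if (i < n)%N then X1 i else if (i < 2 * n)%N then X2 (i - n)%N else Y (i - 2 * n)%N.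
pose ev : {rmorphism A -> R} := mmap intr h.
have evE d t : (d < 3)%N -> (t < n)%N -> ev (x d t) = nth 0 [:: X1 t; X2 t; Y t] d.
  move=> d3 tn; rewrite /x /ev /= mmapX mmap1U /h inordK; last by nia.
  case: d d3 => [|[|[|]]] // _; rewrite ?mul0n ?mul1n.
  - by rewrite add0n tn.
  - by rewrite ltnNge leq_addr /= mul2n -addnn ltn_add2l tn addKn.
  - by rewrite ltnNge mul2n -addnn -addnA leq_addr addnA /= ltnNge leq_addr /= addKn.
have /(congr1 ev) := generic.
rewrite -det_map_mx (rmorph_MX hk (X1' := X1) (X2' := X2) (Y' := Y));
  try by move=> t tn; rewrite evE.
rewrite (rmorph_det_value (X1' := X1) (X2' := X2) (Y' := Y)) // => t tn;
  by rewrite evE.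
Qed.
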